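(* Let $k$ be a field of characteristic $\neq 2$ containing a primitive fourth root of unity $\sqrt{-1}$. The Ueno–Campana threefold $X$ over $k$ is unirational over $k$: there exists a dominant rational map $\mathbb{P}^3 \dashrightarrow X$ defined over $k$.
   Context: Let $C\subset\mathbb{P}^2$ be the elliptic curve $y^2z = x(x^2-z^2)$ (homogeneous coordinates $[x:y:z]$), with the order-4 automorphism $g$ given by $[x:y:z]\mapsto[-x:\sqrt{-1}\,y:z]$. Let $C_1,C_2,C_3$ be three copies of $(C,g)$, $Z=C_1\times C_2\times C_3$, and let $g$ also denote the diagonal automorphism $(g,g,g)$ of $Z$, which has order 4. The quotient $Y=Z/\langle g\rangle$ has $8$ singular points of type $\frac14(1,1,1)$ and $28$ singular points of type $\frac12(1,1,1)$. The Ueno–Campana threefold $X$ is the blow-up of $Y$ at the maximal ideals of these singular points; it is a smooth projective threefold over $k$, birational to $Z/\langle g\rangle$, and its function field is $k(X)=k(Z)^g$. *)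

(* Defs.v *)
From HB Require Import structures.
From mathcomp Require Import all_boot all_order all_algebra.
Set Implicit Arguments. Unset Strict Implicit. Unset Printing Implicit Defensive.
Import Order.TTheory GRing.Theory Num.Theory.
Local Open Scope ring_scope.

(* Rational function field k(t1,t2,t3) = function field of P^3 over k,
   built as iterated fraction fields of univariate polynomial rings. *)
Definition Kt1 (k : fieldType) : fieldType := {fraction {poly k}}.
Definition Kt2 (k : fieldType) : fieldType := {fraction {poly Kt1 k}}.
Definition Kt3 (k : fieldType) : fieldType := {fraction {poly Kt2 k}}.

Definition cst3 (k : fieldType) (c : k) : Kt3 k :=
  @FracField.tofrac {poly Kt2 k}
    (polyC (@FracField.tofrac {poly Kt1 k}
      (polyC (@FracField.tofrac {poly k} (polyC c))))).

Definition eval3 (k F : fieldType) (emb : k -> F)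
    (p : {poly {poly {poly k}}}) (a b c : F) : F :=
  (map_poly (fun q : {poly {poly k}} =>
      (map_poly (fun r : {poly k} => (map_poly emb r).[a]) q).[b]) p).[c].

Definition alg_indep3 (k F : fieldType) (emb : k -> F) (a b c : F) : Prop :=
  forall p : {poly {poly {poly k}}}, eval3 emb p a b c = 0 -> p = 0.

Definition field_generated (k F : fieldType) (emb : k -> F)
    (x y : 'I_3 -> F) : Prop :=
  forall S : F -> Prop,
    (forall c, S (emb c)) -> (forall j, S (x j)) -> (forall j, S (y j)) ->
    (forall u v, S u -> S v -> S (u + v)) ->
    (forall u, S u -> S (- u)) ->
    (forall u v, S u -> S v -> S (u * v)) ->
    (forall u, S u -> S (u^-1)) ->
    forall f, S f.

(* (F, emb, x, y) is a model of the function field k(Z) of Z = C1 x C2 x C3,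
   C : y^2 = x^3 - x (affine chart z = 1 of y^2 z = x (x^2 - z^2)):
   (x_j, y_j) is a generic point of Z and generates F over k. *)
Definition is_function_field_of_Z (k F : fieldType) (emb : {rmorphism k -> F})
    (x y : 'I_3 -> F) : Prop :=
  [/\ forall j, y j ^+ 2 = x j ^+ 3 - x j,
      alg_indep3 emb (x 0%R) (x 1%R) (x 2%R)
    & field_generated emb x y].

(* g acts on k(Z) as the pullback of the diagonal automorphism
   [x:y:z] |-> [-x : i y : z] on each factor, fixing k. *)
Definition is_g_action (k F : fieldType) (emb : {rmorphism k -> F}) (i : k)
    (x y : 'I_3 -> F) (g : {rmorphism F -> F}) : Prop :=
  [/\ forall c, g (emb c) = emb c,
      forall j, g (x j) = - x j
    & forall j, g (y j) = emb i * y j].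

(* A k-embedding of the fixed field k(X) = k(Z)^g into k(t1,t2,t3),
   i.e. a dominant rational map P^3 --> X defined over k. *)
Definition k_embedding_of_invariants (k F : fieldType)
    (emb : {rmorphism k -> F}) (g : {rmorphism F -> F}) (psi : F -> Kt3 k) : Prop :=
  [/\ forall c, psi (emb c) = cst3 c,
      forall u v, g u = u -> g v = v -> psi (u + v) = psi u + psi v
    & forall u v, g u = u -> g v = v -> psi (u * v) = psi u * psi v].

(* Main.v *)
Require Import Defs.
From HB Require Import structures.
From mathcomp Require Import all_boot all_order all_algebra.
From mathcomp Require Import ring.
From Stdlib Require Import Classical ClassicalEpsilon.
Import GRing.Theory.
Local Open Scope ring_scope.

(** Put s = x_1^2, u = x_2/x_1, v = x_3/x_1, a = y_2/y_1 and b = y_3/y_1. These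
    are invariant under g, and k(Z) = k(s,u,v,a,b)(y_1) with y_1^4 in
    k(s,u,v,a,b), on which g acts by y_1 |-> i y_1; hence
    k(X) = k(s,u,v)(a,b), where
      a^2 = u (u^2 s - 1)/(s - 1)  and  b^2 = v (v^2 s - 1)/(s - 1).
    Eliminating s gives a conic bundle over the (u,v)-plane. After the base
    change u = p^2, v = q^2, a = p A, b = q B the conic becomes
      (1 - q^4)(A^2 - 1) = (1 - p^4)(B^2 - 1),
    which has the rational point A = B = 1. The lines through that point give a
    parameter t, and k(X) embeds into k(p,q,t). *)

(** * Iterated evaluation and algebraic independence *)

(* The morphism R[X] -> F extending [f] with X |-> a. It is injective iff [f] is
   and [a] is transcendental over the image of [f]; iterating it three times
   gives [eval3]. *)
Definition evx {R F : comNzRingType} (f : {rmorphism R -> F}) (a : F)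
  (p : {poly R}) : F := (map_poly f p).[a].

Section Evx.
Context {R F : comNzRingType}.
Implicit Types (f : {rmorphism R -> F}) (a b : F).

Lemma evx_is_zmod_morphism f a : zmod_morphism (evx f a).
Proof. by move=> p q; rewrite /evx rmorphB hornerD hornerN. Qed.

Lemma evx_is_monoid_morphism f a : monoid_morphism (evx f a).
Proof.
by split=> [|p q]; rewrite /evx ?rmorph1 ?hornerC // rmorphM hornerM.
Qed.

HB.instance Definition _ f a :=
  GRing.isZmodMorphism.Build {poly R} F (evx f a) (evx_is_zmod_morphism f a).
HB.instance Definition _ f a :=
  GRing.isMonoidMorphism.Build {poly R} F (evx f a)
    (evx_is_monoid_morphism f a).

End Evx.

Section EvxTheory.
Context {R F : comNzRingType}.
Implicit Types (f : {rmorphism R -> F}) (a b : F).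

Lemma evxC f a c : evx f a c%:P = f c.
Proof. by rewrite /evx map_polyC hornerC. Qed.

Lemma evxX f a : evx f a 'X = a.
Proof. by rewrite /evx map_polyX hornerX. Qed.

Lemma evx_MXaddC f a (p : {poly R}) c :
  evx f a (p * 'X + c%:P) = evx f a p * a + f c.
Proof. by rewrite rmorphD rmorphM /= evxX evxC. Qed.

End EvxTheory.

Section EvxMorph.
Context {R F : comNzRingType}.
Implicit Types (f : {rmorphism R -> F}) (a b : F).

Lemma eq_evx (R' : comNzRingType) (g : {rmorphism R' -> R}) f
    (f' : {rmorphism R' -> F}) a p :
  f' =1 f \o g -> evx f' a p = evx f a (map_poly g p).
Proof.
move=> ff'; elim/poly_ind: p => [|p c IHp].
  by rewrite map_poly0 !rmorph0.
rewrite evx_MXaddC IHp rmorphD rmorphM /= map_polyX map_polyC.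
by rewrite evx_MXaddC ff'.
Qed.

Lemma evx_morph (S : comNzRingType) (j : {rmorphism F -> S})
    f (f' : {rmorphism R -> S}) a p :
  f' =1 j \o f -> j (evx f a p) = evx f' (j a) p.
Proof.
move=> ff'; elim/poly_ind: p => [|p c IHp]; first by rewrite !rmorph0.
by rewrite !evx_MXaddC rmorphD rmorphM /= IHp ff'.
Qed.

Lemma evx_comp f a (p q : {poly R}) : evx f a (p \Po q) = evx f (evx f a q) p.
Proof.
elim/poly_ind: p => [|p c IHp]; first by rewrite comp_poly0 !rmorph0.
rewrite comp_polyD comp_polyM comp_polyX comp_polyC rmorphD rmorphM /= IHp.
by rewrite evx_MXaddC evxC.
Qed.

End EvxMorph.

Lemma evx_swapXY (R F : comNzRingType) (f : {rmorphism R -> F}) a b p :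
  evx (evx f b) a (swapXY p) = evx (evx f a) b p.
Proof.
elim/poly_ind: p => [|p c IHp]; first by rewrite !rmorph0.
rewrite rmorphD rmorphM /= swapXY_X swapXY_polyC rmorphD rmorphM /= IHp.
rewrite evx_MXaddC evxC /= evxX; congr (_ + _).
by rewrite -(@eq_evx _ _ _ polyC (evx f b) f) // => r; rewrite /= evxC.
Qed.

Lemma map_poly_rmorph_inj (R S : nzRingType) (g : {rmorphism R -> S}) :
  injective g -> injective (map_poly g).
Proof.
move=> gI p q /polyP epq; apply/polyP => j; apply: gI.
by have := epq j; rewrite !coef_map.
Qed.

(** * Algebraic independence under changes of variables *)

Section Inj.
Context {R : idomainType} {F : comNzRingType}.
Implicit Types (f : {rmorphism R -> F}) (a b : F).

Lemma evx_inj_comp f a (q : {poly R}) :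
  (1 < size q)%N -> injective (evx f a) -> injective (evx f (evx f a q)).
Proof.
move=> sq fI p1 p2; rewrite -!evx_comp => /fI /eqP.
by rewrite -subr_eq0 -raddfB comp_poly_eq0 // subr_eq0 => /eqP.
Qed.

Lemma evx_inj_scale f a r :
  r != 0 -> injective (evx f a) -> injective (evx f (a * f r)).
Proof.
move=> r0 fI; have -> : a * f r = evx f a ('X * r%:P).
  by rewrite rmorphM /= evxX evxC.
by apply: evx_inj_comp; rewrite // mulrC mul_polyC size_scale // size_polyX.
Qed.

Lemma evx_inj_precomp (R' : comNzRingType) (g : {rmorphism R' -> R})
    f (f' : {rmorphism R' -> F}) a :
  f' =1 f \o g -> injective g -> injective (evx f a) -> injective (evx f' a).
Proof.
move=> ff' gI fI p q; rewrite !(eq_evx _ _ _ _ _ _ ff') => /fI.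
exact: map_poly_rmorph_inj.
Qed.

End Inj.

Lemma evx_inj_swap (R F : comNzRingType) (f : {rmorphism R -> F}) a b :
  injective (evx (evx f a) b) -> injective (evx (evx f b) a).
Proof.
move=> fI p q; rewrite -[p]swapXYK -[q]swapXYK.
rewrite (evx_swapXY _ _ _ _ _ (swapXY p)) (evx_swapXY _ _ _ _ _ (swapXY q)).
by move/fI=> ->.
Qed.

Lemma evx_inj_frac (K L : fieldType) (tau : {rmorphism {poly K} -> L})
    (f : {rmorphism K -> L}) (n d : {poly K}) :
  injective tau -> f =1 tau \o polyC -> n != 0 -> n.[0] = 0 -> d.[0] != 0 ->
  injective (evx f (tau n / tau d)).
Proof.
move=> tauI ftau n0 nz dz; set w := _ / _.
have tau_neq0 q : q != 0 -> tau q != 0.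
  by apply: contra_neq; rewrite -[X in _ = X](rmorph0 tau) => /tauI.
have neq0 (q : {poly K}) : q.[0] != 0 -> q != 0.
  by apply: contraNneq => ->; rewrite horner0.
have w0 : w != 0 by rewrite mulf_neq0 ?invr_eq0 ?tau_neq0 // neq0.
(* [w] vanishes at the point 0 of the affine line, so [p(w)] has the value
   [p(0)] there. *)
have ev0 p : exists a b : {poly K},
    [/\ b.[0] != 0, a.[0] = p.[0] * b.[0] & evx f w p * tau b = tau a].
  elim/poly_ind: p => [|p c [a [b [b0 ab Eab]]]].
    by exists 0, 1; rewrite hornerC oner_eq0 !horner0 !mul0r !rmorph0 mul0r.
  exists (a * n + c%:P * b * d), (b * d); split.
  - by rewrite hornerM mulf_neq0.
  - by rewrite !hornerE nz mulr0 add0r.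
  - rewrite evx_MXaddC rmorphD !rmorphM /= -Eab ftau /= mulrDl.
    by rewrite mulrACA /w divfK ?tau_neq0 ?neq0 // mulrA.
have inj0 p : evx f w p = 0 -> p = 0.
  elim/poly_ind: p => // p c IHp Ep.
  have c0 : c = 0.
    have [a [b [b0 ab]]] := ev0 (p * 'X + c%:P).
    rewrite Ep mul0r -(rmorph0 tau) => /tauI a0; move: ab.
    rewrite -a0 horner0 !hornerE => /esym/eqP.
    by rewrite mulf_eq0 (negPf b0) orbF => /eqP.
  move: Ep; rewrite evx_MXaddC c0 rmorph0 addr0 => /eqP.
  by rewrite mulf_eq0 (negPf w0) orbF => /eqP /IHp ->; rewrite mul0r addr0.
move=> p q /eqP; rewrite -subr_eq0 -rmorphB => /eqP /inj0 /eqP.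
by rewrite subr_eq0 => /eqP.
Qed.

Lemma evx_inj_inner (R F : comNzRingType) (f : {rmorphism R -> F}) a b :
  injective (evx (evx f a) b) -> injective (evx f a).
Proof. by move=> fI p q epq; apply/polyC_inj/fI; rewrite !evxC. Qed.

Lemma evx_inj_neq (R F : comNzRingType) (f : {rmorphism R -> F}) a c :
  injective (evx f a) -> a != f c.
Proof.
move=> fI; apply/eqP; rewrite -[in LHS](evxX f a) -(evxC f a c).
move/fI/(congr1 (fun p : {poly R} => size p)).
by rewrite size_polyX size_polyC; case: (c != 0).
Qed.

Lemma comp_poly_inj (R : idomainType) (q : {poly R}) :
  (1 < size q)%N -> injective (comp_poly q).
Proof.
move=> sq p1 p2 /eqP; rewrite -subr_eq0 -rmorphB /= comp_poly_eq0 //.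
by rewrite subr_eq0 => /eqP.
Qed.

(** The substitution is triangular. The outer variable is multiplied by [a], which is the image of a
    nonzero coefficient; on the coefficients, [b] becoming [b * a] is composition with the
    nonconstant polynomial ['X * ('X)%:P]. *)
Lemma evx3_inj_scale (R : idomainType) (F : comNzRingType)
    (f : {rmorphism R -> F}) a b c :
  injective (evx (evx (evx f a) b) c) ->
  injective (evx (evx (evx f a) (b * a)) (c * a)).
Proof.
move=> I3.
have -> : c * a = c * evx (evx f a) b ('X)%:P by rewrite evxC /= evxX.
refine (@evx_inj_precomp _ _ _ (comp_poly ('X * ('X)%:P)) (evx (evx f a) b)
  (evx (evx f a) (b * a)) _ _ _ _).
- by move=> p /=; rewrite evx_comp rmorphM /= evxX evxC /= evxX.
- by apply: comp_poly_inj;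
    rewrite mulrC mul_polyC size_scale ?size_polyX ?polyX_eq0.
- by apply: evx_inj_scale; rewrite // polyC_eq0 polyX_eq0.
Qed.

Lemma evx3_inj_sqr (R : idomainType) (F : comNzRingType)
    (f : {rmorphism R -> F}) a b c :
  injective (evx (evx (evx f a) b) c) ->
  injective (evx (evx (evx f (a ^+ 2)) b) c).
Proof.
have sX2 : (1 < size ('X^2 : {poly R}))%N by rewrite size_polyXn.
apply: (@evx_inj_precomp _ _ _ (map_poly (comp_poly ('X^2 : {poly R})))).
  move=> p /=; apply: eq_evx => q /=.
  by rewrite evx_comp rmorphXn /= evxX.
by apply/map_poly_rmorph_inj/comp_poly_inj.
Qed.

(** The rotation is a swap of the outer two variables followed by a swap of the inner two; the
    latter acts on coefficients through [swapXY]. *)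
Lemma evx3_inj_rot (R : idomainType) (F : comNzRingType)
    (f : {rmorphism R -> F}) a b c :
  injective (evx (evx (evx f a) b) c) -> injective (evx (evx (evx f c) a) b).
Proof.
move=> /(evx_inj_swap _ _ (evx f a)) I.
pose g : {rmorphism {poly {poly R}} -> {poly {poly R}}} := @swapXY R.
have gI : injective g by exact: (can_inj swapXYK).
pose f1 : {rmorphism {poly {poly R}} -> F} := evx (evx f a) c.
pose f2 : {rmorphism {poly {poly R}} -> F} := evx (evx f c) a.
have E : f2 =1 f1 \o g by move=> p; rewrite /= evx_swapXY.
exact: (@evx_inj_precomp {poly {poly R}} F {poly {poly R}} g f1 f2 b E gI I).
Qed.

(** * Isomorphisms between subfields *)

Section PartialIso.
Context {F E : fieldType}.
Implicit Types (G : F -> E -> Prop).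

(* [G] is the graph of an isomorphism between a subring of F and one of E. *)
Record ring_graph G : Prop := RingGraph {
  graphD : forall f h f' h', G f h -> G f' h' -> G (f + f') (h + h');
  graphN : forall f h, G f h -> G (- f) (- h);
  graph1 : G 1 1;
  graphM : forall f h f' h', G f h -> G f' h' -> G (f * f') (h * h');
  graph_eq0 : forall f h, G f h -> f = 0 <-> h = 0
}.

Record field_graph G : Prop := FieldGraph {
  field_ring_graph :> ring_graph G;
  graphV : forall f h, G f h -> G f^-1 h^-1
}.

Section RingGraph.
Context {G : F -> E -> Prop} (ringG : ring_graph G).

Lemma graphB f h f' h' : G f h -> G f' h' -> G (f - f') (h - h').
Proof. by move=> Gf Gf'; apply: graphD => //; apply: graphN. Qed.

Lemma graph0 : G 0 0.
Proof.
by rewrite -(subrr 1) -[X in G _ X](subrr 1); apply: graphB; apply: graph1.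
Qed.

Lemma graphX f h n : G f h -> G (f ^+ n) (h ^+ n).
Proof.
move=> Gf; elim: n => [|n IHn]; first by rewrite !expr0; apply: graph1.
by rewrite !exprS; apply: graphM.
Qed.

Lemma graph_fun f h h' : G f h -> G f h' -> h = h'.
Proof.
move=> Gh Gh'; have := graphB _ _ _ _ Gh Gh'; rewrite subrr.
by move/(graph_eq0 _ ringG) => [/(_ erefl)/eqP + _]; rewrite subr_eq0 => /eqP.
Qed.

Lemma graph_inj f f' h : G f h -> G f' h -> f = f'.
Proof.
move=> Gh Gh'; have := graphB _ _ _ _ Gh Gh'; rewrite subrr.
by move/(graph_eq0 _ ringG) => [_ /(_ erefl)/eqP]; rewrite subr_eq0 => /eqP.
Qed.

Lemma graph_neq0 f h : G f h -> (f != 0) = (h != 0).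
Proof.
by move/(graph_eq0 _ ringG) => [fh hf]; congr (~~ _); apply/eqP/eqP.
Qed.

(** Pairs [n / d] with [n' / d']. By [graph_eq0] the denominators are nonzero on both sides and a
    numerator vanishes exactly when its partner does, so independence of the chosen fraction need
    not be proved separately. *)
Lemma frac_graph : exists2 G' : F -> E -> Prop,
  field_graph G' & forall f h, G f h -> G' f h.
Proof.
exists (fun f h => exists n n' d d',
  [/\ G n n', G d d', d != 0, f = n / d & h = n' / d']); last first.
  move=> f h Gf; exists f, h, 1, 1.
  by rewrite !divr1 oner_neq0; split => //; apply: graph1.
have nz d d' : G d d' -> d != 0 -> d' != 0 by move=> /graph_neq0 ->.
split; first split.
- move=> _ _ _ _ [n [n' [d [d' [Gn Gd d0 -> ->]]]]]
  [m [m' [e [e' [Gm Ge e0 -> ->]]]]].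
  have [d'0 e'0] := (nz _ _ Gd d0, nz _ _ Ge e0).
  exists (n * e + m * d), (n' * e' + m' * d'), (d * e), (d' * e').
  by rewrite !addf_div ?mulf_neq0 //; split => //;
    do ?[apply: graphD | apply: graphM].
- move=> _ _ [n [n' [d [d' [Gn Gd d0 -> ->]]]]].
  by exists (- n), (- n'), d, d'; rewrite !mulNr; split => //; apply: graphN.
- by exists 1, 1, 1, 1; rewrite !divr1 oner_neq0; split => //; apply: graph1.
- move=> _ _ _ _ [n [n' [d [d' [Gn Gd d0 -> ->]]]]]
  [m [m' [e [e' [Gm Ge e0 -> ->]]]]].
  exists (n * m), (n' * m'), (d * e), (d' * e').
  by rewrite !mulf_div mulf_neq0 //; split => //; apply: graphM.
- move=> _ _ [n [n' [d [d' [Gn Gd d0 -> ->]]]]].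
  have d'0 := nz _ _ Gd d0.
  have H := graph_eq0 _ ringG _ _ Gn.
  split=> /eqP; rewrite mulf_eq0 invr_eq0 ?(negPf d0) ?(negPf d'0) orbF => /eqP;
    by move/H => ->; rewrite mul0r.
- move=> _ _ [n [n' [d [d' [Gn Gd d0 -> ->]]]]].
  (* By convention the inverse of 0 is 0, so a zero numerator is represented by 0 / 1. *)
  rewrite !invf_div; have [n0|n0] := eqVneq n 0.
    have n'0 : n' = 0 by apply/(graph_eq0 _ ringG _ _ Gn).
    exists 0, 0, 1, 1; rewrite n0 n'0 !invr0 !mulr0 !mul0r oner_neq0.
    by split => //; [apply: graph0 | apply: graph1].
  by exists d, d', n, n'; split.
Qed.

End RingGraph.

(** Both images are copies of [R], so they correspond; the fields of fractions that they generate
    follow by [frac_graph]. *)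
Lemma inj_graph (R : nzRingType) (e1 : {rmorphism R -> F})
    (e2 : {rmorphism R -> E}) :
  injective e1 -> injective e2 ->
  exists2 G : F -> E -> Prop, field_graph G & forall r, G (e1 r) (e2 r).
Proof.
move=> I1 I2; have [|G fG sG] := @frac_graph
    (fun f h => exists2 r, f = e1 r & h = e2 r); last first.
  by exists G => // r; apply: sG; exists r.
split.
- by move=> _ _ _ _ [r -> ->] [s -> ->]; exists (r + s); rewrite rmorphD.
- by move=> _ _ [r -> ->]; exists (- r); rewrite rmorphN.
- by exists 1; rewrite rmorph1.
- by move=> _ _ _ _ [r -> ->] [s -> ->]; exists (r * s); rewrite rmorphM.
- move=> _ _ [r -> ->].
  by split=> [/eqP|/eqP]; rewrite raddf_eq0 // => /eqP ->; rewrite rmorph0.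
Qed.

(* [B'] is [- B] when [b] is already in the domain of [G] and is mapped there to
   the other square root of [d']. *)
Lemma sqrt_graph G (b d : F) (B d' : E) :
  field_graph G -> G d d' -> b ^+ 2 = d -> B ^+ 2 = d' ->
  exists G' : F -> E -> Prop,
    [/\ field_graph G', forall f h, G f h -> G' f h & exists B', G' b B'].
Proof.
move=> fG Gd bd Bd; have rG := field_ring_graph _ fG.
have [bG|bNG] := classic (exists h, G b h); first by exists G.
(* When [b] is new, it is sent to [B]; only the zero test for [c0 + c1 * b] needs an argument. *)
have [|G' fG' sG'] := @frac_graph (fun f h => exists c0 c0' c1 c1',
    [/\ G c0 c0', G c1 c1', f = c0 + c1 * b & h = c0' + c1' * B]); last first.
  have [G0 G1] := (graph0 fG, graph1 _ fG).
  exists G'; split=> // [f h Gf|].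
    by apply: sG'; exists f, h, 0, 0; rewrite !mul0r !addr0.
  by exists B; apply: sG'; exists 0, 0, 1, 1; rewrite !mul1r !add0r.
have [G0 G1] := (graph0 fG, graph1 _ fG).
split.
- move=> _ _ _ _ [c0 [c0' [c1 [c1' [Gc0 Gc1 -> ->]]]]]
  [e0 [e0' [e1 [e1' [Ge0 Ge1 -> ->]]]]].
  exists (c0 + e0), (c0' + e0'), (c1 + e1), (c1' + e1').
  by split; [exact: graphD | exact: graphD | ring | ring].
- move=> _ _ [c0 [c0' [c1 [c1' [Gc0 Gc1 -> ->]]]]].
  exists (- c0), (- c0'), (- c1), (- c1').
  by split; [exact: graphN | exact: graphN | ring | ring].
- by exists 1, 1, 0, 0; rewrite !mul0r !addr0.
- move=> _ _ _ _ [c0 [c0' [c1 [c1' [Gc0 Gc1 -> ->]]]]]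
  [e0 [e0' [e1 [e1' [Ge0 Ge1 -> ->]]]]].
  exists (c0 * e0 + c1 * e1 * d), (c0' * e0' + c1' * e1' * d'),
    (c0 * e1 + c1 * e0), (c0' * e1' + c1' * e0').
  split; do ?[apply: graphD | apply: graphM] => //; rewrite -?bd -?Bd; ring.
- move=> _ _ [c0 [c0' [c1 [c1' [Gc0 Gc1 -> ->]]]]].
  have [c10|c10] := eqVneq c1 0.
    have c1'0 : c1' = 0 by apply/(graph_eq0 _ fG _ _ Gc1).
    by rewrite c10 c1'0 !mul0r !addr0; apply: (graph_eq0 _ fG).
  have c1'0 : c1' != 0 by rewrite -(graph_neq0 fG _ _ Gc1).
  have Gq : G (- c0 / c1) (- c0' / c1').
    by apply: graphM => //; [exact: graphN | exact: graphV].
  (* Vanishing on the left side makes [b] equal to [- c0 / c1]. Vanishing on the right side makes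
     [B] the image of that quotient, so [b] and the quotient have equal squares. Either way [b] lies
     in the domain of [G], a contradiction. *)
  split=> [e|e]; case: bNG.
    exists (- c0' / c1'); suff -> : b = - c0 / c1 by [].
    by apply: (canRL (mulfK c10)); rewrite mulrC; apply/eqP;
      rewrite -addr_eq0 addrC e.
  have EB : B = - c0' / c1'.
    by apply: (canRL (mulfK c1'0)); rewrite mulrC; apply/eqP;
      rewrite -addr_eq0 addrC e.
  have : b ^+ 2 = (- c0 / c1) ^+ 2.
    rewrite bd; apply: (graph_inj fG _ _ _ Gd).
    by rewrite -Bd EB; apply: graphX.
  move/eqP; rewrite eqf_sqr => /orP[]/eqP ->; first by eexists; exact: Gq.
  by eexists; apply: graphN; first exact: fG; exact: Gq.
Qed.

End PartialIso.

(** * Invariants of a quartic Kummer extension *)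

Record subfield (F : fieldType) (D : F -> Prop) : Prop := Subfield {
  subfield1 : D 1;
  subfieldD : forall u v, D u -> D v -> D (u + v);
  subfieldN : forall u, D u -> D (- u);
  subfieldM : forall u v, D u -> D v -> D (u * v);
  subfieldV : forall u, D u -> D u^-1
}.

Section QuarticKummer.
Context {F : fieldType} {g : {rmorphism F -> F}} {D : F -> Prop} {j y : F}.
Context (two_neq0 : (2%:R : F) != 0) (j2 : j ^+ 2 = -1).
Context (subD : subfield F D) (gD : forall c, D c -> g c = c).
Context (Dj : D j) (gy : g y = j * y) (Dy4 : D (y ^+ 4)).

Definition quartic_span f := exists c0 c1 c2 c3, [/\ D c0, D c1, D c2, D c3 &
  f = c0 + c1 * y + c2 * y ^+ 2 + c3 * y ^+ 3].

Let D1 := subfield1 _ _ subD.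
Let DD := subfieldD _ _ subD.
Let DN := subfieldN _ _ subD.
Let DM := subfieldM _ _ subD.
Let DV := subfieldV _ _ subD.

Lemma subfield0 : D 0.
Proof. by rewrite -(subrr 1); apply: DD => //; apply: DN. Qed.
Let D0 := subfield0.

Lemma span_base c : D c -> quartic_span c.
Proof. by move=> Dc; exists c, 0, 0, 0; split => //; ring. Qed.

Lemma span_gen : quartic_span y.
Proof. by exists 0, 1, 0, 0; split => //; ring. Qed.

Lemma spanD u v : quartic_span u -> quartic_span v -> quartic_span (u + v).
Proof.
move=> [c0 [c1 [c2 [c3 [Dc0 Dc1 Dc2 Dc3 ->]]]]]
  [e0 [e1 [e2 [e3 [De0 De1 De2 De3 ->]]]]].
exists (c0 + e0), (c1 + e1), (c2 + e2), (c3 + e3).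
by split; try exact: DD; ring.
Qed.

Lemma spanM u v : quartic_span u -> quartic_span v -> quartic_span (u * v).
Proof.
move=> [c0 [c1 [c2 [c3 [Dc0 Dc1 Dc2 Dc3 ->]]]]]
  [e0 [e1 [e2 [e3 [De0 De1 De2 De3 ->]]]]].
exists (c0 * e0 + (c1 * e3 + c2 * e2 + c3 * e1) * y ^+ 4),
  (c0 * e1 + c1 * e0 + (c2 * e3 + c3 * e2) * y ^+ 4),
  (c0 * e2 + c1 * e1 + c2 * e0 + c3 * e3 * y ^+ 4),
  (c0 * e3 + c1 * e2 + c2 * e1 + c3 * e0).
by split; do ?[by [] | apply: DD | apply: DM]; ring.
Qed.

Lemma spanN u : quartic_span u -> quartic_span (- u).
Proof.
by move=> Su; rewrite -mulN1r; apply: spanM => //; apply/span_base/DN.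
Qed.

(** The powers of [y] are eigenvectors of [g], with eigenvalues 1, [j], -1 and [- j]. *)
Lemma g_spanE c0 c1 c2 c3 : D c0 -> D c1 -> D c2 -> D c3 ->
  g (c0 + c1 * y + c2 * y ^+ 2 + c3 * y ^+ 3) =
  c0 + (c1 * j) * y + (- c2) * y ^+ 2 + (- (c3 * j)) * y ^+ 3.
Proof.
move=> Dc0 Dc1 Dc2 Dc3; rewrite !(rmorphD, rmorphXn, rmorphM) /= gy !gD //.
by rewrite !exprMn [j ^+ 3]exprS j2; ring.
Qed.

Lemma span_g u : quartic_span u -> quartic_span (g u).
Proof.
move=> [c0 [c1 [c2 [c3 [Dc0 Dc1 Dc2 Dc3 ->]]]]].
exists c0, (c1 * j), (- c2), (- (c3 * j)); rewrite g_spanE //.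
by split; do ?[by [] | apply: DN | apply: DM].
Qed.

Lemma g4_span u : quartic_span u -> g (g (g (g u))) = u.
Proof.
move=> [c0 [c1 [c2 [c3 [Dc0 Dc1 Dc2 Dc3 ->]]]]].
rewrite !g_spanE; do ?[by [] | apply: DN | apply: DM].
have -> : c1 * j * j * j * j = c1 * (j ^+ 2) ^+ 2 by ring.
rewrite j2.
have -> : - (- (- (- (c3 * j) * j) * j) * j) = c3 * (j ^+ 2) ^+ 2 by ring.
by rewrite j2; ring.
Qed.

Lemma span_fixed u : quartic_span u -> g u = u -> D u.
Proof.
move=> [c0 [c1 [c2 [c3 [Dc0 Dc1 Dc2 Dc3 uE]]]]] gu.
(* [e1], [e2] and [e3] expand the first three iterates of [g] at [u], all equal to [u]. *)
have e1 : u = c0 + c1 * j * y - c2 * y ^+ 2 - c3 * j * y ^+ 3.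
  by rewrite -gu uE g_spanE //; ring.
have e2 : u = c0 - c1 * y + c2 * y ^+ 2 - c3 * y ^+ 3.
  rewrite -gu -gu uE g_spanE // g_spanE; do ?[by [] | apply: DN | apply: DM].
  have -> : c1 * j * j = c1 * j ^+ 2 by ring.
  have -> : - (- (c3 * j) * j) = c3 * j ^+ 2 by ring.
  by rewrite j2; ring.
have e3 : u = c0 - c1 * j * y - c2 * y ^+ 2 + c3 * j * y ^+ 3.
  rewrite -gu e2 !(rmorphB, rmorphD, rmorphXn, rmorphM) /= gy !gD //.
  by rewrite !exprMn [j ^+ 3]exprS j2; ring.
suff -> : u = c0 by [].
(* [4 u] is the trace of [u], in which only [c0] survives. *)
apply: (mulfI two_neq0); apply: (mulfI two_neq0).
have -> : 2%:R * (2%:R * u) = u + u + u + u by ring.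
by rewrite {1}e1 {1}e2 {1}e3 uE; ring.
Qed.

(** The norm of [u] is fixed, hence in [D], and can be inverted there. The span is thus a field, as
    needed to show that it contains everything the coordinates generate. *)
Lemma spanV u : quartic_span u -> quartic_span u^-1.
Proof.
move=> Su; have [->|u0] := eqVneq u 0; first by rewrite invr0; apply: span_base.
(* [u * w] is the norm of [u]. *)
pose w := g u * g (g u) * g (g (g u)).
have Sw : quartic_span w by do ?[by [] | apply: spanM | apply: span_g].
have Du : D (u * w).
  apply: span_fixed; first exact: spanM.
  by rewrite !rmorphM /= (g4_span u Su) /w; ring.
have w0 : w != 0 by rewrite !mulf_neq0 ?fmorph_eq0.
have -> : u^-1 = w * (u * w)^-1 by rewrite invfM mulrCA divff // mulr1.
by apply: spanM => //; apply/span_base/DV.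
Qed.

End QuarticKummer.

(** * The conic bundle *)

(* With w = s/(1 - s) the two equations read (a/p)^2 = 1 + be w and
   (b/q)^2 = 1 + al w; their solutions are found on the line
   b/q - 1 = t (a/p - 1). *)
Lemma conic_parametrization (K : fieldType) (p q t : K) :
  let al := 1 - q ^+ 4 in let be := 1 - p ^+ 4 in
  let n := 4%:R * t * (1 - t) * (be * t - al) in
  let d := al - be * t ^+ 2 in
  let s := n / (n + d ^+ 2) in
  d != 0 -> n + d ^+ 2 != 0 -> exists a b : K,
    a ^+ 2 * (s - 1) = p ^+ 2 * ((p ^+ 2) ^+ 2 * s - 1) /\
    b ^+ 2 * (s - 1) = q ^+ 2 * ((q ^+ 2) ^+ 2 * s - 1).
Proof.
move=> al be n d s d0 nd0.
(* The line meets the conic again at a/p = 1 + m, b/q = 1 + t m with m = 2 (be t - al) / d. Then w =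
   m (m + 2) / be = n / d^2, and s = w / (1 + w). *)
exists (p * ((2%:R * be * t - be * t ^+ 2 - al) / d)),
  (q * ((al + be * t ^+ 2 - 2%:R * al * t) / d)).
rewrite /s; move: d0 nd0; rewrite /n /d /al /be => d0 nd0.
by split; field; apply/andP.
Qed.

(** * A generic point of the conic bundle over k(p,q,t) *)

Section GenericPoint.
Context {k K1 K2 K3 : fieldType}.
Context {tau1 : {rmorphism {poly k} -> K1}}.
Context {tau2 : {rmorphism {poly K1} -> K2}}.
Context {tau3 : {rmorphism {poly K2} -> K3}}.
Context (tau1I : injective tau1) (tau2I : injective tau2).
Context (tau3I : injective tau3) (two_neq0 : (2%:R : k) != 0).

Lemma generic_point (c : {rmorphism k -> K3}) :
  (forall r, c r = tau3 (tau2 (tau1 r%:P)%:P)%:P) ->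
  exists s u v a b : K3,
  [/\ injective (evx (evx (evx c s) (u * s)) (v * s)),
      a ^+ 2 * (s - 1) = u * (u ^+ 2 * s - 1) &
      b ^+ 2 * (s - 1) = v * (v ^+ 2 * s - 1)].
Proof.
move=> cE.
pose i1 : {rmorphism k -> K1} := tau1 \o polyC.
pose i2 : {rmorphism K1 -> K2} := tau2 \o polyC.
pose i3 : {rmorphism K2 -> K3} := tau3 \o polyC.
have sqI (K L : fieldType) (tau : {rmorphism {poly K} -> L})
    (f : {rmorphism K -> L}) : injective tau -> f =1 tau \o polyC ->
    injective (evx f (tau 'X ^+ 2)).
  move=> tI ft; have := evx_inj_frac _ _ tau f ('X^2) 1 tI ft.
  rewrite rmorph1 divr1 rmorphXn /=; apply.
  - by rewrite expf_neq0 ?polyX_eq0.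
  - by rewrite !hornerE expr0n.
  - by rewrite hornerC oner_eq0.
pose p := i2 (tau1 'X); pose q := tau2 'X.
pose al := 1 - q ^+ 4; pose be := 1 - p ^+ 4.
pose n := 4%:R * 'X * (1 - 'X) * (be%:P * 'X - al%:P).
pose d := al%:P - be%:P * 'X ^+ 2.
have two2 : (2%:R : K2) != 0.
  by rewrite -(rmorph_nat i2) fmorph_eq0 -(rmorph_nat i1) fmorph_eq0.
have al0 : al != 0.
  have -> : al = tau2 (1 - 'X^4) by rewrite rmorphB rmorph1 rmorphXn.
  rewrite -(rmorph0 tau2) (inj_eq tau2I).
  apply/eqP => /(congr1 (horner^~ 0)) /eqP; rewrite !hornerE /=.
  by rewrite expr0n subr0 oner_eq0.
have hn z : n.[z] = 4%:R * z * (1 - z) * (be * z - al).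
  by rewrite /n -polyC_natr !hornerE.
have hd z : d.[z] = al - be * z ^+ 2 by rewrite /d !hornerE.
have n_neq0 : n != 0.
  have neq0 (r : {poly K2}) : r.[0] != 0 -> r != 0.
    by apply: contraNneq => ->; rewrite horner0.
  rewrite /n !mulf_neq0 ?polyX_eq0 ?neq0 //.
  - by rewrite -polyC_natr hornerC (natrM _ 2 2) mulf_neq0.
  - by rewrite hornerD hornerN hornerX hornerC subr0 oner_neq0.
  - rewrite hornerD hornerN hornerM hornerX !hornerC mulr0 add0r.
    by rewrite oppr_eq0.
(* At t = 0, [n] vanishes and [d] equals [al], so [s] has a zero there and no pole: the situation of
   [evx_inj_frac]. *)
have nd0 : (n + d ^+ 2).[0] != 0.
  rewrite hornerD horner_exp hn hd expr0n !(mulr0, mul0r) subr0 add0r.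
  by rewrite expf_neq0.
pose s := tau3 n / tau3 (n + d ^+ 2).
(* Independence is climbed along the tower: p^2 over k, q^2 over [K1], [s] over [K2], with
   [evx_inj_precomp] shrinking the coefficients to the subring already reached. *)
have I : injective (evx (evx (evx c (i3 p ^+ 2)) (i3 q ^+ 2)) s).
  pose h1 : {rmorphism {poly k} -> K1} := evx i1 (tau1 'X ^+ 2).
  have h1I : injective h1 by apply: sqI.
  pose h1' : {rmorphism {poly k} -> K2} := i2 \o h1.
  pose h2 : {rmorphism {poly {poly k}} -> K2} := evx h1' (q ^+ 2).
  have h2I : injective h2.
    apply: (@evx_inj_precomp K1 K2 _ h1 i2 h1' _ _ h1I) => //.
    exact: sqI tau2I _.
  pose f1 : {rmorphism {poly k} -> K3} := evx c (i3 p ^+ 2).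
  pose f2 : {rmorphism {poly {poly k}} -> K3} := evx f1 (i3 q ^+ 2).
  have f1E : f1 =1 i3 \o h1'.
    move=> r; change (f1 r = i3 (i2 (evx i1 (tau1 'X ^+ 2) r))).
    pose i21 : {rmorphism k -> K2} := i2 \o i1.
    rewrite (evx_morph _ i2 _ i21) // (evx_morph _ i3 _ c) //.
    by rewrite /f1 -!rmorphXn.
  have f2E : f2 =1 i3 \o h2.
    move=> r; change (f2 r = i3 (evx h1' (q ^+ 2) r)).
    by rewrite (evx_morph _ i3 _ f1) // /f2 -!rmorphXn.
  apply: (@evx_inj_precomp K2 K3 _ h2 i3 f2 _ f2E h2I).
  apply: (evx_inj_frac _ _ tau3 i3 n (n + d ^+ 2) tau3I _ n_neq0) => //.
  by rewrite hn !(mulr0, mul0r).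
have d_neq0 : tau3 d != 0.
  rewrite -(rmorph0 tau3) (inj_eq tau3I).
  apply/eqP => /(congr1 (horner^~ 0)) /eqP.
  by rewrite hd horner0 expr0n mulr0 subr0 (negPf al0).
have nd_neq0 : tau3 (n + d ^+ 2) != 0.
  rewrite -(rmorph0 tau3) (inj_eq tau3I).
  by apply: contraNneq nd0 => ->; rewrite horner0.
have alE : tau3 al%:P = 1 - i3 q ^+ 4.
  by rewrite -[LHS]/(i3 al) rmorphB rmorph1 rmorphXn.
have beE : tau3 be%:P = 1 - i3 p ^+ 4.
  by rewrite -[LHS]/(i3 be) rmorphB rmorph1 rmorphXn.
have dE : tau3 d = (1 - i3 q ^+ 4) - (1 - i3 p ^+ 4) * tau3 'X ^+ 2.
  by rewrite rmorphB rmorphM rmorphXn alE beE.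
have nE : tau3 n = 4%:R * tau3 'X * (1 - tau3 'X) *
    ((1 - i3 p ^+ 4) * tau3 'X - (1 - i3 q ^+ 4)).
  rewrite (rmorphM tau3 (_ * _)) (rmorphM tau3 (_ * _)) (rmorphM tau3 _%:R).
  rewrite rmorph_nat (rmorphB tau3 1) rmorph1 (rmorphB tau3 (be%:P * _)).
  by rewrite (rmorphM tau3 be%:P) alE beE.
have := conic_parametrization _ (i3 p) (i3 q) (tau3 'X).
lazy zeta; rewrite -nE -dE -(rmorphXn tau3 2 d) -(rmorphD tau3 n).
move=> /(_ d_neq0 nd_neq0) [a [b [Ea Eb]]].
exists s, (i3 p ^+ 2), (i3 q ^+ 2), a, b; split=> //.
exact/evx3_inj_scale/evx3_inj_rot.
Qed.

End GenericPoint.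

(** * From a generic point to an embedding of the invariants *)

Lemma alg_indep3_inj (k F : fieldType) (emb : {rmorphism k -> F}) a b c :
  alg_indep3 emb a b c -> injective (evx (evx (evx emb a) b) c).
Proof.
move=> indep p q /eqP; rewrite -subr_eq0 -rmorphB => /eqP /indep /eqP.
by rewrite subr_eq0 => /eqP.
Qed.

Lemma ord3_ind (P : 'I_3 -> Prop) : P 0 -> P 1 -> P 2%:R -> forall j, P j.
Proof.
move=> P0 P1 P2 [[|[|[|//]]] lt].
- by rewrite (_ : Ordinal lt = 0) //; apply: val_inj.
- by rewrite (_ : Ordinal lt = 1) //; apply: val_inj.
- by rewrite (_ : Ordinal lt = 2%:R) //; apply: val_inj.
Qed.

(** An isomorphism sending s, u, v to [S], [U], [V] is extended to a and b by two square roots. The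
    Kummer argument shows that its domain contains every invariant. *)
Lemma invariants_embed (k F E : fieldType) (i : k) (emb : {rmorphism k -> F})
    (cst : {rmorphism k -> E}) (x y : 'I_3 -> F) (g : {rmorphism F -> F})
    (S U V A B : E) :
  (2%:R : k) != 0 -> i ^+ 2 = -1 ->
  is_function_field_of_Z emb x y -> is_g_action emb i x y g ->
  injective (evx (evx (evx cst S) (U * S)) (V * S)) ->
  A ^+ 2 * (S - 1) = U * (U ^+ 2 * S - 1) ->
  B ^+ 2 * (S - 1) = V * (V ^+ 2 * S - 1) ->
  exists psi : F -> E,
  [/\ forall c, psi (emb c) = cst c,
      forall u v, g u = u -> g v = v -> psi (u + v) = psi u + psi v &
      forall u v, g u = u -> g v = v -> psi (u * v) = psi u * psi v].
Proof.
move=> hchar hi [curve indep gen] [g_emb g_x g_y] IE EA EB.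
have xI := alg_indep3_inj _ _ _ _ _ _ indep.
have x0_neq0 : x 0 != 0.
  rewrite -(rmorph0 emb) evx_inj_neq //.
  by do 2 apply: evx_inj_inner; exact: xI.
(* The monomials [x 0 ^+ 2], [x 1 * x 0], [x 2%:R * x 0] are s, us, vs. They generate the same field
   as s, u, v while remaining polynomial in the coordinates. *)
have IF := evx3_inj_sqr _ _ _ _ _ _ (evx3_inj_scale _ _ _ _ _ _ xI).
pose s := x 0 ^+ 2; pose u := x 1 / x 0; pose v := x 2%:R / x 0.
pose a := y 1 / y 0; pose b := y 2%:R / y 0.
have s_neq0 : s != 0 by rewrite expf_neq0.
have s1_neq0 : s - 1 != 0.
  rewrite subr_eq0 -(rmorph1 emb) evx_inj_neq //.
  by do 2 apply: evx_inj_inner; exact: IF.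
have y2 j : y j ^+ 2 = x j * (x j ^+ 2 - 1) by rewrite curve; ring.
have y0_neq0 : y 0 != 0 by rewrite -sqrf_eq0 y2 mulf_neq0.
have aE : a ^+ 2 = u * (u ^+ 2 * s - 1) / (s - 1).
  by rewrite expr_div_n !y2 /u /s; field; rewrite s1_neq0 x0_neq0.
have bE : b ^+ 2 = v * (v ^+ 2 * s - 1) / (s - 1).
  by rewrite expr_div_n !y2 /v /s; field; rewrite s1_neq0 x0_neq0.
have [G0 fG0 sG0] := inj_graph _ _ _ IF IE.
have Gc c : G0 (emb c) (cst c).
  by have := sG0 c%:P%:P%:P; rewrite /= !evxC /= !evxC /= !evxC.
have Gs : G0 s S.
  by have := sG0 'X%:P%:P; rewrite /= !evxC /= !evxC /= !evxX.
have Gm : G0 (x 1 * x 0) (U * S).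
  by have := sG0 'X%:P; rewrite /= !evxC /= !evxX.
have Gn : G0 (x 2%:R * x 0) (V * S).
  by have := sG0 'X; rewrite /= !evxX.
have rG0 := field_ring_graph _ fG0.
have S_neq0 : S != 0 by rewrite -(graph_neq0 rG0 _ _ Gs).
have Gs1 : G0 (s - 1) (S - 1) by apply: graphB => //; apply: graph1.
have S1_neq0 : S - 1 != 0 by rewrite -(graph_neq0 rG0 _ _ Gs1).
have Gu : G0 u U.
  rewrite (_ : u = x 1 * x 0 / s); last by rewrite /u /s; field.
  by rewrite -[U](mulfK S_neq0); apply: graphM => //; apply: graphV.
have Gv : G0 v V.
  rewrite (_ : v = x 2%:R * x 0 / s); last by rewrite /v /s; field.
  by rewrite -[V](mulfK S_neq0); apply: graphM => //; apply: graphV.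
have Gd w W : G0 w W ->
    G0 (w * (w ^+ 2 * s - 1) / (s - 1)) (W * (W ^+ 2 * S - 1) / (S - 1)).
  move=> Gw; apply: graphM => //; last exact: graphV.
  apply: graphM => //; apply: graphB => //; last exact: graph1.
  by apply: graphM => //; apply: graphX.
have [|G1 [fG1 G01 [A' Ga]]] := sqrt_graph _ a _ A _ fG0 (Gd _ _ Gu) aE.
  by rewrite -EA mulfK.
have [|G [fG G1G [B' Gb]]] :=
  sqrt_graph _ b _ B _ fG1 (G01 _ _ (Gd _ _ Gv)) bE.
  by rewrite -EB mulfK.
have rG := field_ring_graph _ fG.
have G0G f h : G0 f h -> G f h by move=> /G01/G1G.
(* Invariants on which the isomorphism is defined; [Dfix] shows that these are all the
   invariants. *)
pose D f := g f = f /\ exists h, G f h.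
have subD : subfield F D.
  split.
  - by split; [rewrite rmorph1 | exists 1; apply: graph1].
  - move=> f f' [gf [h Gf]] [gf' [h' Gf']].
    by split; [rewrite rmorphD gf gf' | exists (h + h'); apply: graphD].
  - move=> f [gf [h Gf]].
    by split; [rewrite rmorphN gf | exists (- h); apply: graphN].
  - move=> f f' [gf [h Gf]] [gf' [h' Gf']].
    by split; [rewrite rmorphM gf gf' | exists (h * h'); apply: graphM].
  - move=> f [gf [h Gf]].
    by split; [rewrite fmorphV gf | exists h^-1; apply: graphV].
have Demb c : D (emb c) by split=> //; exists (cst c); apply: G0G.
have Ds : D s by split; [rewrite rmorphXn /= g_x sqrrN | exists S; apply: G0G].
have Du : D u.
  by split; [rewrite fmorph_div /= !g_x invrN mulrNN | exists U; apply: G0G].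
have Dv : D v.
  by split; [rewrite fmorph_div /= !g_x invrN mulrNN | exists V; apply: G0G].
have i_neq0 : emb i != 0.
  rewrite fmorph_eq0; apply/eqP => i0; move: hi; rewrite i0 expr0n => /eqP.
  by rewrite eq_sym oppr_eq0 oner_eq0.
have gdiv w : g (w / y 0) = g w / (emb i * y 0) by rewrite fmorph_div /= g_y.
have Da : D a.
  split; last by exists A'; apply: G1G.
  by rewrite gdiv g_y /a; field; rewrite i_neq0 y0_neq0.
have Db : D b.
  split; last by exists B'.
  by rewrite gdiv g_y /b; field; rewrite i_neq0 y0_neq0.
have DM := subfieldM _ _ subD.
have DV := subfieldV _ _ subD.
have Ds1 : D (s - 1).
  apply: (subfieldD _ _ subD) => //.
  exact/(subfieldN _ _ subD)/(subfield1 _ _ subD).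
have Dy4 : D (y 0 ^+ 4).
  rewrite (_ : y 0 ^+ 4 = s * ((s - 1) * (s - 1))).
    by apply: (DM) => //; apply: (DM).
  by rewrite (exprM _ 2 2) y2 /s; ring.
have F2 : (2%:R : F) != 0 by rewrite -(rmorph_nat emb) fmorph_eq0.
have j2 : emb i ^+ 2 = -1 by rewrite -rmorphXn hi rmorphN1.
have gD c : D c -> g c = c by case.
pose Sp := @quartic_span F D (y 0).
(* The curve equation reads y_1^2 = x_1 (s - 1), so x_1 is y_1^2 divided by an element of [D]. *)
have Sx0 : Sp (x 0).
  rewrite (_ : x 0 = (s - 1)^-1 * (y 0 * y 0)).
    apply: spanM => //; first exact/span_base/DV.
    by apply: spanM => //; apply: span_gen.
  by rewrite -expr2 y2 mulrC mulfK.
have Sall f : Sp f.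
  apply: gen => {f}.
  - by move=> c; apply: span_base.
  - apply: ord3_ind => //.
      by rewrite -[x 1](divfK x0_neq0); apply: spanM => //; apply: span_base.
    by rewrite -[x 2%:R](divfK x0_neq0); apply: spanM => //; apply: span_base.
  - apply: ord3_ind; first exact: span_gen.
      rewrite -[y 1](divfK y0_neq0); apply: spanM => //.
        exact: span_base.
      exact: span_gen.
    rewrite -[y 2%:R](divfK y0_neq0); apply: spanM => //.
      exact: span_base.
    exact: span_gen.
  - by move=> *; apply: spanD.
  - by move=> *; apply: spanN.
  - by move=> *; apply: spanM.
  - by move=> *; apply: (@spanV F g D (emb i) (y 0)).
have Dfix f : g f = f -> D f.
  by apply: (span_fixed F2 j2 subD gD _ _ f (Sall f)).
(* Any image under [G] will do, since [graph_fun] makes it unique; outside the domain of [G] the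
   value is arbitrary. *)
pose psi f := epsilon (inhabits (0 : E)) (G f).
have Gpsi f : g f = f -> G f (psi f).
  by move=> /Dfix [_ Gf]; apply: epsilon_spec.
exists psi; split.
- by move=> c; apply: (graph_fun rG _ _ _ (Gpsi _ (g_emb c))); apply: G0G.
- move=> f f' gf gf'; apply: (graph_fun rG (f + f')).
    by apply: Gpsi; rewrite rmorphD gf gf'.
  by apply: graphD => //; apply: Gpsi.
- move=> f f' gf gf'; apply: (graph_fun rG (f * f')).
    by apply: Gpsi; rewrite rmorphM gf gf'.
  by apply: graphM => //; apply: Gpsi.
Qed.

Theorem theorem1 (k : fieldType) (i : k)
    (hchar : (2%:R : k) != 0) (hi : i ^+ 2 = -1)
    (F : fieldType) (emb : {rmorphism k -> F}) (x y : 'I_3 -> F)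
    (g : {rmorphism F -> F})
    (hZ : is_function_field_of_Z emb x y)
    (hg : is_g_action emb i x y g) :
  exists psi : F -> Kt3 k, k_embedding_of_invariants emb g psi.
Proof.
have tofracI (R : idomainType) : injective (@FracField.tofrac R).
  by move=> u v /eqP; rewrite tofrac_eq => /eqP.
pose t1 : {rmorphism {poly k} -> Kt1 k} := @FracField.tofrac {poly k}.
pose t2 : {rmorphism {poly Kt1 k} -> Kt2 k} := @FracField.tofrac {poly Kt1 k}.
pose t3 : {rmorphism {poly Kt2 k} -> Kt3 k} := @FracField.tofrac {poly Kt2 k}.
(* This is [cst3] written as a composite of morphisms, so that it carries a morphism structure. *)
pose cst : {rmorphism k -> Kt3 k} :=
  t3 \o (polyC \o (t2 \o (polyC \o (t1 \o polyC)))).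
have [s [u [v [a [b [IE Ea Eb]]]]]] := @generic_point k (Kt1 k) (Kt2 k) (Kt3 k)
  t1 t2 t3 (tofracI _) (tofracI _) (tofracI _) hchar cst (fun=> erefl).
exact: (invariants_embed _ _ _ _ _ cst _ _ _ _ _ _ _ _ hchar hi hZ hg IE Ea Eb).
Qed.
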